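(* Let $S^{(i)},S^{(j)}\subseteq\mathbb S_O$ be the finite knowledge bases of a sender $i$ and receiver $j$, let $A^{(i)}=\mathrm{Atom}(S^{(i)})$, and let $W:S_C\rightsquigarrow\hat S_C$ be a carrier kernel with $C(W)>0$. Assume (H1) $A^{(i)}\subseteq S^{(j)}$, and (H2) $S^{(j)}\setminus S^{(i)}\subseteq\mathrm{Cn}(S^{(i)})$. Then: (i) $\mathsf F_{\mathrm{Cn}}(S^{(i)},S^{(j)})=1$; (ii) there exists a sequence of $(n,|S^{(i)}|)$ semantic block codes with message set $S^{(i)}$, encoding into $S_C^n$ and decoding into $\hat S_O=S^{(j)}$, with $P^{(n)}_{e,\mathrm{Cn}}\to0$ as $n\to\infty$, provided $\log|A^{(i)}|/n<C(W)$; (iii) if moreover for any distinct $a_1,a_2\in A^{(i)}$ the sets $R(a_1),R(a_2)$ are disjoint, where $R(m):=\{\hat s\in S^{(j)}: d_{\mathrm{Cn}}(m,\hat s\mid S^{(i)})=0\}$, then any $(n,|S^{(i)}|)$ such code with $P^{(n)}_{e,\mathrm{Cn}}\le\epsilon$ satisfies $\log|A^{(i)}|\le\frac{nC(W)+1}{1-\epsilon}$.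
   Context: Setting: all agents share a countable semantic universe $\mathbb S_O$ and a common proof system with deductive closure operator $\mathrm{Cn}$ (reflexive, monotone, idempotent; $\mathrm{Cn}(\Gamma)=\bigcup_nT^n(\Gamma)$ for the immediate consequence operator $T$, which is monotone, computable and stabilizes on finite inputs). Knowledge bases are finite subsets of $\mathbb S_O$ listed in a canonical order; $\mathrm{Atom}(S)$ is obtained by scanning $S$ in canonical order from $A=S$ and deleting $s$ whenever $s\in\mathrm{Cn}(A\setminus\{s\})$. Standing assumptions: full encoding and decoding enabling (the encoder may map any state of $S^{(i)}$ to any symbol of $S_C$; the decoder may output any state of $S^{(j)}$), $|S_C|\ge\max_k|S^{(k)}|$ over agents $k$, $|\hat S_C|\ge|S_C|$. Logs base 2, $0\le\epsilon<1$. $C(W)=\max_{P_C}I(\mathsf S_c;\hat{\mathsf S}_c)$; $W$ is used memorylessly over blocks of length $n$. Closure fidelity: $\mathsf F_{\mathrm{Cn}}(S,\hat S)=|\mathrm{Cn}(S)\cap\mathrm{Cn}(\hat S)|/|\mathrm{Cn}(S)\cup\mathrm{Cn}(\hat S)|$ with $0/0:=1$. Closure distortion relative to $S^{(i)}$: for $s\in S^{(i)}$, $d_{\mathrm{Cn}}(s,\hat s\mid S^{(i)})=1-|C_s\cap C_{\hat s}|/|C_s\cup C_{\hat s}|$ with $C_s=\mathrm{Cn}(S^{(i)})$, $C_{\hat s}=\mathrm{Cn}((S^{(i)}\setminus\{s\})\cup\{\hat s\})$, $0/0:=0$. An $(n,M)$ semantic block code: message set $\mathcal M\subseteq S^{(i)}$,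 $|\mathcal M|=M$, $f_n:\mathcal M\to S_C^n$, $g_n:\hat S_C^n\to S^{(j)}$; $\hat{\mathsf S}^{(m)}=g_n(Y^n)$, $Y^n\sim W^{\otimes n}(\cdot\mid f_n(m))$; $P^{(n)}_{e,\mathrm{Cn}}:=\max_m\Pr[d_{\mathrm{Cn}}(m,\hat{\mathsf S}^{(m)}\mid S^{(i)})>0]$.
   Formalization: In (ii) the receiver's knowledge base S^(j) is assumed nonempty: if S^(j) is empty (possible when S^(i) lies in Cn of the empty set, so A^(i) is empty), no decoder into S^(j) exists and the claim fails. *)

(* Defs.v *)
From HB Require Import structures.
From mathcomp Require Import all_boot all_order all_algebra finmap.
From mathcomp Require Import all_classical all_reals all_analysis.
Set Implicit Arguments.
Unset Strict Implicit.
Unset Printing Implicit Defensive.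
Import Order.TTheory GRing.Theory Num.Theory.
Import numFieldNormedType.Exports.
Local Open Scope fset_scope.
Local Open Scope classical_set_scope.
Local Open Scope ring_scope.

(* Partial recursive functions, with arguments passed as a list. *)
Inductive recfun : Type :=
| RZero
| RSucc
| RProj of nat
| RComp of recfun & seq recfun
| RPrec of recfun & recfun
| RMin of recfun.

Inductive rec_eval : recfun -> seq nat -> nat -> Prop :=
| eval_zero xs : rec_eval RZero xs 0
| eval_succ x xs : rec_eval RSucc (x :: xs) x.+1
| eval_proj i xs : (i < size xs)%N -> rec_eval (RProj i) xs (nth 0%N xs i)
| eval_comp f gs xs ys z :
    size ys = size gs ->
    (forall i, (i < size gs)%N ->
      rec_eval (nth RZero gs i) xs (nth 0%N ys i)) ->
    rec_eval f ys z -> rec_eval (RComp f gs) xs z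
| eval_prec0 f g xs z :
    rec_eval f xs z -> rec_eval (RPrec f g) (0%N :: xs) z
| eval_precS f g n xs y z :
    rec_eval (RPrec f g) (n :: xs) y -> rec_eval g (n :: y :: xs) z ->
    rec_eval (RPrec f g) (n.+1 :: xs) z
| eval_min f xs n (v : nat -> nat) :
    (forall m, (m < n)%N -> rec_eval f (m :: xs) (v m).+1) ->
    rec_eval f (n :: xs) 0 -> rec_eval (RMin f) xs n.

(* The canonical index of a finite set in recursion theory, relative to the
   coding [choice.pickle] of the universe. *)
Definition fset_code (U : countType) (X : {fset U}) : nat :=
  (\sum_(s <- X) 2 ^ choice.pickle s)%N.

(* A computable operator sends finite sets to finite sets; in particular, the
   closure of a finite set in a [proof_system] is finite. *)
Definition computable_operator (U : countType) (T : set U -> set U) : Prop :=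
  exists f : recfun, forall X : {fset U}, exists Y : {fset U},
    T [set` X] = [set` Y] /\ rec_eval f [:: fset_code X] (fset_code Y).

Record proof_system (U : countType) := ProofSystem {
  step : set U -> set U;
  Cn : set U -> set U;
  step_mono : forall X Y, X `<=` Y -> step X `<=` step Y;
  step_computable : computable_operator step;
  step_stabilizes : forall X, finite_set X ->
    exists n, iter n.+1 step X = iter n step X;
  CnE : forall X, Cn X = \bigcup_n iter n step X;
  Cn_refl : forall X, X `<=` Cn X;
  Cn_mono : forall X Y, X `<=` Y -> Cn X `<=` Cn Y;
  Cn_idem : forall X, Cn (Cn X) = Cn X
}.

(* A canonical order is given by the listing of each knowledge base. *)
Definition canonical_listing (U : countType) (lst : {fset U} -> seq U) : Prop :=
  forall S, perm_eq (lst S) S.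

Section Closure.
Variables (R : realType) (U : countType) (PS : proof_system U).
Implicit Types (S A : {fset U}) (s : U).

Definition Atom (lst : {fset U} -> seq U) S : {fset U} :=
  foldl (fun A s => if s \in Cn PS [set` (A `\ s)%fset] then (A `\ s)%fset else A) S (lst S).

(* [fset_set] is meaningful on finite sets only; it is used below on closures
   of finite sets. *)
Definition set_card (X : set U) : R := #|` fset_set X|%:R.

Definition closure_fidelity S S' : R :=
  let C := Cn PS [set` S] in
  let C' := Cn PS [set` S'] in
  if set_card (C `|` C') == 0 then 1
  else set_card (C `&` C') / set_card (C `|` C').

(* For [s \in S] the denominator is nonzero, since [s] lies in [Cn S]. *)
Definition closure_distortion S s s' : R :=
  let C := Cn PS [set` S] in
  let C' := Cn PS [set` (s' |` (S `\ s))%fset] in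
  1 - set_card (C `&` C') / set_card (C `|` C').

Definition zero_distortion_set S S' s : {fset U} :=
  [fset s' in S' | closure_distortion S s s' == 0]%fset.

End Closure.

Section Channel.
Variables (R : realType) (X Y : finType).

Definition log2 (x : R) : R := ln x / ln 2.

Definition is_distribution (I : finType) (P : I -> R) : Prop :=
  (forall x, 0 <= P x) /\ \sum_x P x = 1.

Definition is_kernel (W : X -> Y -> R) : Prop :=
  forall x, is_distribution (W x).

(* The convention 0 log (0/q) = 0 holds because of the leading factor. *)
Definition mutual_information (J : X -> Y -> R) : R :=
  \sum_x \sum_y
    J x y * log2 (J x y / ((\sum_y' J x y') * (\sum_x' J x' y))).

(* The alphabets are finite, so the supremum is attained. *)
Definition capacity (W : X -> Y -> R) : R :=
  sup [set mutual_information (fun x y => P x * W x y)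
      | P in [set P : X -> R | is_distribution P]].

Definition memoryless (W : X -> Y -> R) n (x : n.-tuple X) (y : n.-tuple Y) : R :=
  \prod_(k < n) W (tnth x k) (tnth y k).

End Channel.

Record block_code (U : countType) (Si Sj : {fset U}) (SC SCh : finType)
    (n M : nat) := BlockCode {
  messages : {fset U};
  messages_sub : (messages `<=` Si)%fset;
  messages_card : #|` messages| = M;
  enc : messages -> n.-tuple SC;
  dec : n.-tuple SCh -> Sj
}.

(* The maximum over an empty message set is 0. *)
Definition closure_error (R : realType) (U : countType) (PS : proof_system U)
    (Si Sj : {fset U}) (SC SCh : finType) (W : SC -> SCh -> R) (n M : nat)
    (c : block_code Si Sj SC SCh n M) : R :=
  \big[Num.max/0]_(m : messages c)
    \sum_(y | 0 < closure_distortion R PS Si (val m) (val (dec c y)))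
      memoryless W (enc m) y.

(* Main.v *)
Require Import Defs.
From HB Require Import structures.
From mathcomp Require Import all_boot all_order all_algebra finmap.
From mathcomp Require Import all_classical all_reals all_analysis.
From mathcomp Require Import ring lra.
Set Implicit Arguments.
Unset Strict Implicit.
Unset Printing Implicit Defensive.
Import Order.TTheory GRing.Theory Num.Theory.
Import numFieldNormedType.Exports.
Local Open Scope fset_scope.
Local Open Scope classical_set_scope.
Local Open Scope ring_scope.


(* Only finitely many messages are sent at every block length, so positive
   capacity is used for achievability only through the existence of two inputs
   with different output laws: a one-hot repetition code with maximum-likelihood
   decoding has error at most |T| rho^(n / |T|), where rho < 1 is the
   Bhattacharyya coefficient of the two laws.  A message outside the atoms may be
   decoded to any state of the receiver, and an atom is sent to itself.

   For the converse, compare each output law with the product of the averaged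
   single-letter output laws, tilted by a factor K = |A| on the decoding event
   and normalised by 2; Gibbs' inequality averaged over the atoms gives
   (1 - eps) log K <= sum_t I(P_t, W) + 1, with P_t the empirical law of the
   t-th letter. *)

(** * Closures of finite sets and zero closure distortion *)

Section ClosureLemmas.
Variables (R : realType) (U : countType) (PS : proof_system U).
Implicit Types (S A X : {fset U}) (s : U).

Lemma Cn_min (X Y : set U) : X `<=` Cn PS Y -> Cn PS X `<=` Cn PS Y.
Proof. by move=> XY; rewrite -[Cn PS Y]Cn_idem; apply: Cn_mono. Qed.

Lemma Cn_eq (X Y : set U) : X `<=` Cn PS Y -> Y `<=` Cn PS X -> Cn PS X = Cn PS Y.
Proof. by move=> XY YX; apply/seteqP; split; apply: Cn_min. Qed.

Lemma iter_step_finite X n : finite_set (iter n (step PS) [set` X]).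
Proof.
suff [Z ->] : exists Z : {fset U}, iter n (step PS) [set` X] = [set` Z].
  exact: finite_fset.
elim: n => [|n [Z ih]] /=; first by exists X.
have [f /(_ Z) [Z' [ZZ' _]]] := step_computable PS.
by exists Z'; rewrite ih.
Qed.

(** The iterates are constant from the stabilization stage on, so the union defining the closure is
    a union of finitely many finite stages. *)
Lemma Cn_finite X : finite_set (Cn PS [set` X]).
Proof.
have [n nP] := step_stabilizes PS (finite_fset X).
have stab k : iter (n + k) (step PS) [set` X] = iter n (step PS) [set` X].
  by elim: k => [|k ih]; rewrite ?addn0// addnS /= ih.
rewrite CnE; apply: (@sub_finite_set _ _
  (\bigcup_(k in `I_n.+1) iter k (step PS) [set` X])).
  move=> s [k _ sk]; case: (ltnP k n.+1) => [kn|nk]; first by exists k.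
  by exists n => //=; rewrite -(stab (k - n)%N) subnKC// ltnW.
by apply: bigcup_finite => // k _; exact: iter_step_finite.
Qed.

(** Each deleted state is derivable from those left at that moment, so no deletion changes the
    closure. *)
Lemma AtomP lst S :
  (Atom PS lst S `<=` S)%fset /\ Cn PS [set` Atom PS lst S] = Cn PS [set` S].
Proof.
(* The accumulator is generalised separately from the scanned list, whose argument stays [S]. *)
rewrite /Atom; elim: (lst S) {1 3 4 6}S => [|a l ih] A //=.
have [aC|_] := boolP (a \in Cn PS [set` (A `\ a)%fset]); last exact: ih.
have [AA' CA'] := ih (A `\ a)%fset; split.
  exact: fsubset_trans AA' (fsubD1set _ _).
rewrite CA'; apply: Cn_eq => t /=.
  by rewrite in_fsetD1 => /andP[_ tA]; exact: Cn_refl.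
move=> tA; have [->|ta] := eqVneq t a; first exact: set_mem.
by apply: Cn_refl => /=; rewrite in_fsetD1 ta.
Qed.

Lemma set_card_le (X Y : set U) : finite_set X -> finite_set Y ->
  X `<=` Y -> set_card R X <= set_card R Y.
Proof.
by move=> fX fY XY; rewrite ler_nat fsubset_leq_card// -fset_set_sub.
Qed.

Lemma closure_distortion_ge0 S s s' : 0 <= closure_distortion R PS S s s'.
Proof.
rewrite /closure_distortion subr_ge0; set C := Cn _ _; set C' := Cn _ _.
have [fC fC'] : finite_set C /\ finite_set C' by split; exact: Cn_finite.
have [->|c0] := eqVneq (set_card R (C `|` C')) 0; first by rewrite invr0 mulr0.
rewrite ler_pdivrMr ?mul1r; last by rewrite lt0r c0 ler0n.
apply: set_card_le; [exact: finite_setIl | by rewrite finite_setU |].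
by move=> t [Ct _]; left.
Qed.

Lemma closure_distortion0 S s s' : s \in S ->
  Cn PS [set` (s' |` (S `\ s))%fset] = Cn PS [set` S] ->
  closure_distortion R PS S s s' = 0.
Proof.
move=> sS CC; rewrite /closure_distortion CC setIid setUid divff ?subrr//.
(* The quotient is 1 only for a nonempty closure, and this one contains [s]. *)
rewrite pnatr_eq0 cardfs_eq0; apply/eqP => C0.
have : s \in fset_set (Cn PS [set` S]).
  by rewrite in_fset_set ?inE; [exact: Cn_refl | exact: Cn_finite].
by rewrite C0 inE.
Qed.

Lemma closure_distortion_id S s : s \in S -> closure_distortion R PS S s s = 0.
Proof. by move=> sS; apply: closure_distortion0 => //; rewrite fsetD1K. Qed.

(** The generating set [A] survives the removal of [s], and the inserted [s'] is already derivable,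
    so the substitution leaves the closure unchanged. *)
Lemma closure_distortion_redundant S A s s' : s \in S ->
  (A `<=` S `\ s)%fset -> Cn PS [set` A] = Cn PS [set` S] ->
  s' \in Cn PS [set` S] -> closure_distortion R PS S s s' = 0.
Proof.
move=> sS AS CA /set_mem s'C; apply: closure_distortion0 => //.
apply: Cn_eq => [t /=|].
  rewrite in_fset1U => /orP[/eqP->//|].
  by rewrite in_fsetD1 => /andP[_ tS]; exact: Cn_refl.
apply: subset_trans (@Cn_refl _ PS _) _; rewrite -CA; apply: Cn_mono => t /= tA.
by rewrite in_fset1U (fsubsetP AS)// orbT.
Qed.

Lemma closure_fidelity1 S S' : Cn PS [set` S] = Cn PS [set` S'] ->
  closure_fidelity R PS S S' = 1.
Proof.
move=> CC; rewrite /closure_fidelity CC setIid setUid.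
by case: eqVneq => // c0; rewrite divff.
Qed.

End ClosureLemmas.

(** * Memoryless extensions and positive capacity *)

Lemma log2_1 (R : realType) : log2 (1 : R) = 0.
Proof. by rewrite /log2 ln1 mul0r. Qed.

Section Memoryless.
Variables (R : realType) (X Y : finType).
Implicit Types (W : X -> Y -> R).

Lemma sum_tuple_prod n (F : 'I_n -> Y -> R) :
  \sum_(y : n.-tuple Y) \prod_(k < n) F k (tnth y k) =
  \prod_(k < n) \sum_y F k y.
Proof.
rewrite bigA_distr_bigA (reindex (fun f : {ffun 'I_n -> Y} => [tuple f k | k < n])).
  by apply: eq_bigr => f _; apply: eq_bigr => k _; rewrite tnth_mktuple.
exists (fun y : n.-tuple Y => [ffun k => tnth y k]) => [f _|y _].
  by apply/ffunP => k; rewrite ffunE tnth_mktuple.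
by apply: eq_from_tnth => k; rewrite tnth_mktuple ffunE.
Qed.

Lemma memoryless_ge0 W n (x : n.-tuple X) y : is_kernel W -> 0 <= memoryless W x y.
Proof. by move=> hW; apply: prodr_ge0 => k _; have [->] := hW (tnth x k). Qed.

Lemma sum_memoryless W n (x : n.-tuple X) : is_kernel W ->
  \sum_y memoryless W x y = 1.
Proof.
move=> hW; rewrite (sum_tuple_prod (fun k y => W (tnth x k) y)).
by rewrite big1// => k _; have [_ ->] := hW (tnth x k).
Qed.

(** Every coordinate other than [t] sums to 1, which leaves the single-letter marginal. *)
Lemma sum_memoryless_tnth W n (x : n.-tuple X) (t : 'I_n) (u : Y -> R) :
  is_kernel W ->
  \sum_y memoryless W x y * u (tnth y t) = \sum_y W (tnth x t) y * u y.
Proof.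
move=> hW.
pose F k y := W (tnth x k) y * (if k == t then u y else 1).
transitivity (\sum_(y : n.-tuple Y) \prod_(k < n) F k (tnth y k)).
  apply: eq_bigr => y _; rewrite big_split/=; congr (_ * _).
  by rewrite (bigD1 t)//= eqxx big1 ?mulr1// => k /negbTE ->.
rewrite sum_tuple_prod (bigD1 t)//= [X in _ * X]big1 ?mulr1.
  by apply: eq_bigr => y _; rewrite /F eqxx.
move=> k /negbTE kt; rewrite /F kt.
by under eq_bigr do rewrite mulr1; have [_ ->] := hW (tnth x k).
Qed.

(** If all rows of [W] agreed, input and output would be independent under every input law and every
    mutual information would vanish. *)
Lemma capacity_gt0_neq W : is_kernel W -> 0 < capacity W ->
  exists x x' y, W x y != W x' y.
Proof.
move=> hW; apply: contraPP => W1; apply/negP; rewrite -leNgt.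
have Wc x x' y : W x y = W x' y.
  by apply/eqP; apply: contrapT => /negP Wxy; apply: W1; exists x, x', y.
rewrite /capacity; set E := (X in sup X).
(* With no input law at all, [sup] takes its default value 0. *)
have [->|/set0P E0] := eqVneq E set0; first by rewrite sup0.
apply: ge_sup => // _ [P [_ P1] <-].
rewrite /mutual_information big1// => x _; rewrite big1// => y _.
rewrite -mulr_sumr; have [_ ->] := hW x; rewrite mulr1.
rewrite (eq_bigr (fun x' => P x' * W x y)) => [|x' _]; last by rewrite (Wc x' x).
rewrite -mulr_suml P1 mul1r.
have [->|PW0] := eqVneq (P x * W x y) 0; first by rewrite mul0r.
by rewrite divff// log2_1 mulr0.
Qed.

End Memoryless.

(** * Achievability: repetition code and maximum-likelihood decoding *)

Section RepetitionCode.
Variables (R : realType) (X Y T : finType) (W : X -> Y -> R).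
Hypothesis hW : is_kernel W.

Definition bhattacharyya x x' : R := \sum_y Num.sqrt (W x y * W x' y).

Lemma bhattacharyya_ge0 x x' : 0 <= bhattacharyya x x'.
Proof. by apply: sumr_ge0 => y _; exact: sqrtr_ge0. Qed.

Lemma bhattacharyyaC x x' : bhattacharyya x x' = bhattacharyya x' x.
Proof. by apply: eq_bigr => y _; rewrite mulrC. Qed.

Lemma bhattacharyya_refl x : bhattacharyya x x = 1.
Proof.
have [W0 <-] := hW x; apply: eq_bigr => y _.
by rewrite -expr2 sqrtr_sqr ger0_norm.
Qed.

(** This is the AM-GM inequality; its equality case makes the Bhattacharyya coefficient of distinct
    laws strictly less than 1. *)
Lemma sqrt_mul_le_mean (u v : R) : 0 <= u -> 0 <= v ->
  Num.sqrt (u * v) <= (u + v) / 2 ?= iff (u == v).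
Proof.
move=> u0 v0; have m0 : 0 <= (u + v) / 2 by rewrite divr_ge0 ?addr_ge0.
have [le eq] := leif_AGM2 u v; split.
  by rewrite -[leRHS]ger0_norm// -sqrtr_sqr ler_wsqrtr.
apply: etrans eq; rewrite -{1}[(u + v) / 2]ger0_norm// -sqrtr_sqr.
by rewrite eqr_sqrt ?sqr_ge0// mulr_ge0.
Qed.

Lemma bhattacharyya_lt1 x x' y : W x y != W x' y -> bhattacharyya x x' < 1.
Proof.
move=> Wxy; have [[W0 W1] [W0' W1']] := (hW x, hW x').
have -> : 1 = \sum_y (W x y + W x' y) / 2 :> R.
  by rewrite -mulr_suml big_split/= W1 W1' divff.
have le z := sqrt_mul_le_mean (W0 z) (W0' z).
rewrite /bhattacharyya (bigD1 y)//= [ltRHS](bigD1 y)//=.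
apply: ltr_leD; last by apply: ler_sum => z _; exact: (le z).
by rewrite (lt_leif (le y)).
Qed.

(** Positions are dealt out to the messages cyclically, so each message owns at least [n %/ #|T|]
    positions at every block length. *)
Definition one_hot (x x' : X) n (a : T) : n.-tuple X :=
  [tuple if (k %% #|T|)%N == enum_rank a :> nat then x else x' | k < n].

Lemma sum_sqrt_memoryless n (c c' : n.-tuple X) :
  \sum_y Num.sqrt (memoryless W c y * memoryless W c' y) =
  \prod_(k < n) bhattacharyya (tnth c k) (tnth c' k).
Proof.
rewrite -sum_tuple_prod; apply: eq_bigr => y _.
rewrite /memoryless -big_split/=.
elim/big_rec2: _ => [|k u v _ <-]; first by rewrite sqrtr1.
rewrite sqrtrM//; have [W0 _] := hW (tnth c k); have [W0' _] := hW (tnth c' k).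
exact: mulr_ge0.
Qed.

Lemma leq_count_mod n K r : (r < K)%N ->
  (n %/ K <= #|[pred k : 'I_n | (k %% K)%N == r]|)%N.
Proof.
move=> rK.
have lt (q : 'I_(n %/ K)) : (q * K + r < n)%N.
  apply: (@leq_trans ((n %/ K) * K)); last exact: leq_divM.
  apply: (@leq_trans (q.+1 * K)); last by rewrite leq_mul2r ltn_ord orbT.
  by rewrite mulSn addnC ltn_add2r.
pose f q := Ordinal (lt q).
have f_inj : injective f.
  move=> p q /(congr1 val)/= /addIn/eqP; rewrite eqn_pmul2r; last exact: leq_ltn_trans rK.
  by move=> /eqP/val_inj.
rewrite -[X in (X <= _)%N]card_ord -(card_codom f_inj); apply: subset_leq_card.
apply/fintype.subsetP => _ /codomP[q ->]; rewrite inE/= modnMDl.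
by rewrite modn_small.
Qed.

(** On the positions owned by [a] the codewords read [x] and [x'] and contribute the factor [rho];
    every other factor is at most 1. *)
Lemma sum_sqrt_one_hot_le n x x' (a b : T) : bhattacharyya x x' <= 1 -> a != b ->
  \sum_y Num.sqrt (memoryless W (one_hot x x' n a) y *
                   memoryless W (one_hot x x' n b) y) <=
  bhattacharyya x x' ^+ (n %/ #|T|).
Proof.
move=> rho1 ab; rewrite sum_sqrt_memoryless; set rho := bhattacharyya x x'.
pose D := [pred k : 'I_n | (k %% #|T|)%N == enum_rank a].
have [rho0 rC] := (bhattacharyya_ge0 x x', bhattacharyyaC x x').
apply: (@le_trans _ _ (rho ^+ #|D|)); last first.
  by apply: ler_wiXn2l => //; exact: leq_count_mod.
rewrite -prodr_const [leRHS]big_mkcond/=.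
apply: ler_prod => k _; rewrite !tnth_mktuple bhattacharyya_ge0/= /D inE.
case: ifPn => [/eqP ->|_].
  by rewrite (inj_eq val_inj) (inj_eq enum_rank_inj) (negbTE ab).
by case: ifP; rewrite ?bhattacharyya_refl// -rC.
Qed.

Definition ml_decode n (c : T -> n.-tuple X) (t0 : T) (y : n.-tuple Y) : T :=
  [arg max_(a > t0) memoryless W (c a) y]%O.

(** If [b] is decoded, its likelihood is at least that of [a], so the likelihood of [a] is at most
    the geometric mean of the two; then sum over all wrong [b]. *)
Lemma ml_error_le n (c : T -> n.-tuple X) t0 a :
  \sum_(y | ml_decode c t0 y != a) memoryless W (c a) y <=
  \sum_(b | b != a) \sum_y Num.sqrt (memoryless W (c a) y * memoryless W (c b) y).
Proof.
rewrite (partition_big (ml_decode c t0) (fun b => b != a))//=.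
apply: ler_sum => b _; rewrite [leLHS]big_mkcond/=; apply: ler_sum => y _.
case: ifP => [/andP[_ /eqP <-]|_]; last exact: sqrtr_ge0.
rewrite /ml_decode; case: arg_maxP => // b' _ /(_ a isT) le.
have p0 := memoryless_ge0 (c a) y hW.
by rewrite -{1}[memoryless W (c a) y]ger0_norm// -sqrtr_sqr ler_wsqrtr// expr2 ler_wpM2l.
Qed.

Lemma exists_code_error_cvg0 (t0 : T) : 0 < capacity W ->
  exists (enc : forall n, T -> n.-tuple X) (dec : forall n, n.-tuple Y -> T)
    (e : nat -> R), (forall n a,
      \sum_(y | dec n y != a) memoryless W (enc n a) y <= e n) /\
    e n @[n --> \oo] --> (0 : R).
Proof.
move=> /(capacity_gt0_neq hW)[x [x' [y /bhattacharyya_lt1 rho1]]].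
exists (one_hot x x'), (fun n => ml_decode (one_hot x x' n) t0).
set rho := bhattacharyya x x' in rho1 *.
exists (fun n => #|T|%:R * rho ^+ (n %/ #|T|)); split=> [n a|].
  apply: le_trans (ml_error_le _ _ _) _.
  apply: (@le_trans _ _ (\sum_(b : T | b != a) rho ^+ (n %/ #|T|))).
    by apply: ler_sum => b ba; apply: sum_sqrt_one_hot_le (ltW rho1) _; rewrite eq_sym.
  rewrite sumr_const -[leLHS]mulr_natl ler_wpM2r ?exprn_ge0 ?bhattacharyya_ge0//.
  by rewrite ler_nat max_card.
apply: (@cvg_comp _ _ _ (fun n => n %/ #|T|)%N (geometric #|T|%:R rho) _ \oo).
  by apply: cvg_divnr; apply/card_gt0P; exists t0.
by apply: cvg_geometric; rewrite ger0_norm// bhattacharyya_ge0.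
Qed.

End RepetitionCode.

(** * Weak converse through Gibbs' inequality *)

Lemma ln_le_subr1 (R : realType) (x : R) : 0 < x -> ln x <= x - 1.
Proof.
move=> x0; rewrite -{1}[x](subrK 1) addrC.
by apply: le_ln1Dx; rewrite ltrBrDl subrr.
Qed.

Lemma ln_prod (R : realType) (I : finType) (F : I -> R) : (forall i, 0 < F i) ->
  ln (\prod_i F i) = \sum_i ln (F i).
Proof.
move=> F0; suff [] : 0 < \prod_i F i /\ ln (\prod_i F i) = \sum_i ln (F i) by [].
elim/big_rec2: _ => [|i s p _ [p0 <-]]; first by rewrite ln1.
by rewrite lnM ?posrE// mulr_gt0.
Qed.

(** Positive capacity excludes the default value 0 of [sup], so the supremum is a genuine upper
    bound. *)
Lemma mutual_information_le_capacity (R : realType) (X Y : finType)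
    (W : X -> Y -> R) P : 0 < capacity W -> is_distribution P ->
  mutual_information (fun x y => P x * W x y) <= capacity W.
Proof.
move=> C0 PP; apply: sup_upper_bound; last by exists P.
by apply: contrapT => /sup_out C1; move: C0; rewrite /capacity C1 ltxx.
Qed.

Section Converse.
Variables (R : realType) (X Y T : finType) (W : X -> Y -> R).
Hypothesis hW : is_kernel W.
Hypothesis T_gt0 : (0 < #|T|)%N.

Local Notation K := (#|T|%:R : R).

Let K_gt0 : 0 < K. Proof. by rewrite ltr0n. Qed.
Let K_neq0 : K != 0. Proof. by rewrite gt_eqF. Qed.
Let W_ge0 x y : 0 <= W x y. Proof. by have [] := hW x. Qed.

Definition empirical (u : T -> X) (x : X) : R := \sum_(a | u a == x) K^-1.

Lemma sum_empirical u (g : X -> R) :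
  \sum_x empirical u x * g x = K^-1 * \sum_a g (u a).
Proof.
rewrite mulr_sumr [RHS](partition_big u predT)//=.
apply: eq_bigr => x _; rewrite mulr_suml.
by apply: eq_bigr => a /eqP ->.
Qed.

Lemma empirical_distribution u : is_distribution (empirical u).
Proof.
split=> [x|]; first by apply: sumr_ge0 => a _; rewrite invr_ge0 ltW.
under eq_bigr do rewrite -[empirical _ _]mulr1.
by rewrite (sum_empirical u (fun=> 1)) sumr_const mulVf.
Qed.

(** This is the output law of [W] under the input law [empirical u]. *)
Definition output_mean (u : T -> X) (y : Y) : R := K^-1 * \sum_a W (u a) y.

Lemma output_mean_ge0 u y : 0 <= output_mean u y.
Proof. by rewrite mulr_ge0 ?invr_ge0 ?(ltW K_gt0)// sumr_ge0. Qed.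

Lemma output_mean_gt0 u a y : 0 < W (u a) y -> 0 < output_mean u y.
Proof.
move=> Wa; rewrite mulr_gt0 ?invr_gt0// (bigD1 a)//= ltr_pwDl//.
exact: sumr_ge0.
Qed.

Lemma sum_output_mean u : \sum_y output_mean u y = 1.
Proof.
rewrite -mulr_sumr exchange_big/= (eq_bigr (fun=> 1)).
  by rewrite sumr_const mulVf.
by move=> a _; have [] := hW (u a).
Qed.

Lemma mutual_information_empirical u :
  mutual_information (fun x y => empirical u x * W x y) =
  K^-1 * \sum_a \sum_y W (u a) y * log2 (W (u a) y / output_mean u y).
Proof.
rewrite -(sum_empirical u (fun x => \sum_y W x y * log2 (W x y / output_mean u y))).
apply: eq_bigr => x _; rewrite mulr_sumr; apply: eq_bigr => y _.
rewrite -mulr_sumr; have [_ ->] := hW x; rewrite mulr1.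
rewrite (sum_empirical u (W^~ y)) -/(output_mean u y) -mulrA.
have [->|P0] := eqVneq (empirical u x) 0; first by rewrite !mul0r.
by rewrite -mulf_div divff// mul1r.
Qed.

Variables (n : nat) (c : T -> n.-tuple X) (E : T -> pred (n.-tuple Y)).

Let q (k : 'I_n) : Y -> R := output_mean (fun a => tnth (c a) k).

Definition product_output (y : n.-tuple Y) : R := \prod_(k < n) q k (tnth y k).

Lemma product_output_ge0 y : 0 <= product_output y.
Proof. by apply: prodr_ge0 => k _; exact: output_mean_ge0. Qed.

Lemma sum_product_output : \sum_y product_output y = 1.
Proof.
by rewrite (sum_tuple_prod q) big1// => k _; exact: sum_output_mean.
Qed.

(** With p the codeword's output law and Q = [product_output], this is [ln t <= t - 1] at t = b Q /
    p, multiplied by p. Where p vanishes the left side is nonpositive. *)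
Lemma gibbs_pointwise a y (b : R) : 0 < b ->
  memoryless W (c a) y - product_output y * b <=
  memoryless W (c a) y *
    (\sum_(k < n) ln (W (tnth (c a) k) (tnth y k) / q k (tnth y k)) - ln b).
Proof.
move=> b0; set p := memoryless _ _ _; set Q := product_output y.
have p_ge0 : 0 <= p by exact: memoryless_ge0.
have [p0|p_neq0] := eqVneq p 0.
  by rewrite p0 mul0r sub0r oppr_le0 mulr_ge0 ?product_output_ge0// ltW.
have W_gt0 k : 0 < W (tnth (c a) k) (tnth y k).
  rewrite lt0r W_ge0 andbT; apply: contra_neq p_neq0 => W0.
  by rewrite /p /memoryless (bigD1 k)//= W0 mul0r.
have q_gt0 k : 0 < q k (tnth y k) by apply: (@output_mean_gt0 _ a).
have p_gt0 : 0 < p by rewrite lt0r p_neq0.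
have Q_gt0 : 0 < Q by apply: prodr_gt0 => k _.
rewrite -ln_prod => [|k]; last by rewrite divr_gt0.
rewrite prodf_div -/p -/Q -ln_div ?posrE ?divr_gt0//.
rewrite -lerN2 opprB -mulrN -lnV ?posrE ?divr_gt0// !invf_div.
have le : ln (b * (Q / p)) <= b * (Q / p) - 1.
  by apply: ln_le_subr1; rewrite mulr_gt0// divr_gt0.
apply: (le_trans (ler_wpM2l p_ge0 le)).
rewrite mulrBr mulr1 lerD2r.
by rewrite [leLHS](_ : _ = Q * b)//; field.
Qed.

Hypothesis E_disj : forall a a' y, E a y -> E a' y -> a = a'.

(** At most one event contains [y]: one term equals [K], and the remaining ones add up to at most
    [K]. *)
Lemma sum_bonus_le y : \sum_a (if E a y then K else 1) <= 2 * K.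
Proof.
have [/existsP[a Ea]|/existsPn E0] := boolP [exists a, E a y].
  rewrite (bigD1 a)//= Ea mulr_natl mulr2n lerD2l.
  rewrite (eq_bigr (fun=> 1)) => [|a' a'a]; last first.
    by case: ifP => // /E_disj/(_ Ea)/eqP; rewrite (negbTE a'a).
  by rewrite sumr_const ler_nat max_card.
rewrite (eq_bigr (fun=> 1)) => [|a _]; last by rewrite (negbTE (E0 a)).
by rewrite sumr_const ler_peMl ?(ltW K_gt0)// ler1n.
Qed.

(* Summing [gibbs_pointwise] over messages and outputs with [b = K / 2] on
   [E a] and [b = 1 / 2] elsewhere plays the role of Fano's inequality: since
   the events are disjoint, the averaged right-hand measures have mass at most 1. *)
Lemma weak_converse (eps : R) : 0 < capacity W ->
  (forall a, 1 - eps <= \sum_(y | E a y) memoryless W (c a) y) ->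
  (1 - eps) * log2 K <= n%:R * capacity W + 1.
Proof.
move=> C0 hE.
have ln2_gt0 : 0 < ln (2 : R) by rewrite ln_gt0// ltr1n.
pose b a y : R := (if E a y then K else 1) / 2.
have b_gt0 a y : 0 < b a y by rewrite /b; case: ifP; rewrite divr_gt0.
(* The information density of the codeword of [a], in nats, split into letters. *)
pose L a (y : n.-tuple Y) : R :=
  \sum_(k < n) ln (W (tnth (c a) k) (tnth y k) / q k (tnth y k)).
pose p a y := memoryless W (c a) y.
have sum_p : \sum_a \sum_y p a y = K.
  by under eq_bigr do rewrite sum_memoryless//; rewrite sumr_const.
have sum_r : \sum_a \sum_y product_output y * b a y <= K.
  rewrite exchange_big/=.
  apply: (@le_trans _ _ (\sum_y product_output y * K)).
    apply: ler_sum => y _; rewrite -mulr_sumr ler_wpM2l ?product_output_ge0//.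
    by rewrite -mulr_suml ler_pdivrMr// mulrC sum_bonus_le.
  by rewrite -mulr_suml sum_product_output mul1r.
(* The mean of [L] over messages and outputs is a sum over letters; each letter contributes its
   empirical mutual information, at most the capacity, and [ln 2] converts bits to nats. *)
have sum_L : K^-1 * \sum_a \sum_y p a y * L a y <= n%:R * capacity W * ln 2.
  rewrite [leLHS](_ : _ = \sum_(k < n) ln 2 *
      mutual_information (fun x y => empirical (fun a => tnth (c a) k) x * W x y)).
    rewrite -mulr_sumr mulrC ler_wpM2r ?(ltW ln2_gt0)//.
    apply: (@le_trans _ _ (\sum_(k < n) capacity W)).
      apply: ler_sum => k _; apply: mutual_information_le_capacity => //.
      exact: empirical_distribution.
    by rewrite sumr_const card_ord mulr_natl.
  under eq_bigr do under eq_bigr do rewrite mulr_sumr.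
  under eq_bigr do rewrite exchange_big/=.
  rewrite exchange_big/= mulr_sumr; apply: eq_bigr => k _.
  rewrite mutual_information_empirical mulrCA; congr (_ * _).
  rewrite mulr_sumr; apply: eq_bigr => a _.
  rewrite (@sum_memoryless_tnth _ _ _ _ _ (c a) k
    (fun z => ln (W (tnth (c a) k) z / q k z)) hW) mulr_sumr.
  apply: eq_bigr => z _; rewrite mulrCA; congr (_ * _).
  by rewrite /log2 mulrCA divff ?mulr1// gt_eqF.
(* The tilt contributes [ln K] on [E a], of probability at least [1 - eps], and the normalisation
   costs [ln 2] everywhere. *)
have sum_b : K^-1 * (\sum_a \sum_y p a y * ln (b a y)) >= (1 - eps) * ln K - ln 2.
  rewrite ler_pdivlMl// mulr_natl -sumr_const; apply: ler_sum => a _.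
  rewrite (eq_bigr (fun y => (if E a y then p a y else 0) * ln K - p a y * ln 2)).
    rewrite sumrB -!mulr_suml -big_mkcond/= sum_memoryless// mul1r lerD2r.
    by rewrite ler_wpM2r ?ln_ge0// ler1n.
  move=> y _; rewrite /b ln_div ?posrE//; last by case: ifP.
  by case: ifP => _; rewrite ?ln1 mulrBr// mulr0 mul0r.
(* By [sum_p] and [sum_r] the left side is nonnegative, so the mean of [ln b] is at most the mean of
   [L]. *)
have : \sum_a \sum_y (p a y - product_output y * b a y) <=
       \sum_a \sum_y p a y * (L a y - ln (b a y)).
  by apply: ler_sum => a _; apply: ler_sum => y _; exact: gibbs_pointwise.
under eq_bigr do rewrite sumrB.
under [leRHS]eq_bigr do under eq_bigr do rewrite mulrBr.
under [leRHS]eq_bigr do rewrite sumrB.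
rewrite !sumrB sum_p => gibbs.
have {gibbs sum_r} : \sum_a \sum_y p a y * ln (b a y) <= \sum_a \sum_y p a y * L a y.
  by lra.
rewrite -(ler_pM2l (_ : 0 < K^-1)) ?invr_gt0// => gibbs.
(* Dividing by [ln 2] turns the normalisation cost into the additive 1. *)
rewrite /log2 mulrA ler_pdivrMr//; lra.
Qed.

End Converse.

(** * From channel codes to semantic block codes *)

Section SemanticCoding.
Variables (R : realType) (U : countType) (PS : proof_system U).
Variables (Si Sj A : {fset U}) (SC SCh : finType) (W : SC -> SCh -> R).
Hypotheses (hW : is_kernel W) (C0 : 0 < capacity W).
Hypotheses (ASi : (A `<=` Si)%fset) (CA : Cn PS [set` A] = Cn PS [set` Si]).

Lemma exists_closure_code : (A `<=` Sj)%fset -> [set` Sj] `<=` Cn PS [set` Si] ->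
  Sj != fset0 ->
  exists c : forall n, block_code Si Sj SC SCh n #|` Si|,
    (forall n, messages (c n) = Si) /\
    closure_error PS W (c n) @[n --> \oo] --> (0 : R).
Proof.
move=> ASj SjC /fset0Pn[s0 s0Sj].
have [enc [dec [e [enc_dec e0]]]] := exists_code_error_cvg0 hW [` s0Sj] C0.
(* The channel code carries the receiver state [h m], not [m]; all non-atoms share the codeword of
   [s0]. *)
pose h (m : Si) : Sj := if val m \in A then insubd [` s0Sj] (val m) else [` s0Sj].
have h0 (m : Si) : closure_distortion R PS Si (val m) (val (h m)) = 0.
  rewrite /h; case: ifPn => mA.
    by rewrite insubdK ?(fsubsetP ASj)//; apply: closure_distortion_id (valP m).
  apply: (closure_distortion_redundant _ (valP m) _ CA); last first.
    by rewrite inE; apply: SjC.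
  apply/fsubsetP => t tA; rewrite in_fsetD1 (fsubsetP ASi)// andbT.
  by apply: contraNneq mA => <-.
pose c n : block_code Si Sj SC SCh n #|` Si| :=
  BlockCode (fsubset_refl Si) (erefl _) (fun m => enc n (h m)) (dec n).
exists c; split=> //; apply: (squeeze_cvgr _ (cvg_cst 0) e0).
near=> n; have e_ge0 : 0 <= e n.
  by apply: le_trans (enc_dec n [` s0Sj]); apply: sumr_ge0 => y _; exact: memoryless_ge0.
rewrite bigmax_ge_id/=; apply: bigmax_le => // m _.
apply: le_trans (enc_dec n (h m)).
rewrite [leLHS]big_mkcond [leRHS]big_mkcond/=; apply: ler_sum => y _.
have p0 := memoryless_ge0 (enc n (h m)) y hW.
case: ifPn => d0; last by case: ifP.
(* Positive distortion forces the decoder output to differ from [h m], which is a channel decoding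
   error. *)
by rewrite ifT//; apply: contraTneq d0 => ->; rewrite h0 ltxx.
Unshelve. all: by end_near. Qed.

(** Restricted to the atoms, the code has disjoint success events, because an output of zero
    distortion for two atoms would lie in both zero-distortion sets. *)
Lemma closure_code_converse (eps : R) n (c : block_code Si Sj SC SCh n #|` Si|) :
  (forall a1 a2, a1 \in A -> a2 \in A -> a1 != a2 ->
     [disjoint zero_distortion_set R PS Si Sj a1
             & zero_distortion_set R PS Si Sj a2]%fset) ->
  0 <= eps < 1 -> closure_error PS W c <= eps ->
  log2 (#|` A|%:R : R) <= (n%:R * capacity W + 1) / (1 - eps).
Proof.
move=> disj /andP[eps0 eps1] c_eps.
have eps1' : 0 < 1 - eps by rewrite subr_gt0.
(* Without atoms the left side is 0, by the convention that [ln 0] is 0. *)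
have [->|A0] := eqVneq #|` A| 0%N.
  rewrite /log2 ln0// mul0r divr_ge0 ?(ltW eps1')//.
  by rewrite addr_ge0// mulr_ge0// ltW.
(* A message set of full cardinality inside [Si] is all of [Si], so every atom is a message. *)
have mSi : messages c = Si.
  apply/eqP; rewrite -(fsubset_leqif_cards (messages_sub c)).
  by rewrite messages_card.
have Am : (A `<=` messages c)%fset by rewrite mSi.
pose E (a : A) (y : n.-tuple SCh) :=
  ~~ (0 < closure_distortion R PS Si (val a) (val (dec c y))).
have R_E (a : A) y : E a y -> val (dec c y) \in zero_distortion_set R PS Si Sj (val a).
  rewrite /E -leNgt => le0; rewrite in_fset /= inE (valP (dec c y))/=.
  by rewrite eq_le le0 closure_distortion_ge0.
rewrite ler_pdivlMr// mulrC cardfE.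
apply: (weak_converse hW _ (c := fun a : A => enc (fincl Am a)) (E := E)) => //.
- by rewrite -cardfE lt0n.
- move=> a a' y /R_E Ea /R_E Ea'; apply/eqP; apply: contraTT Ea => aa'.
  have {}aa' : val a' != val a by rewrite (inj_eq val_inj) eq_sym.
  by have /fdisjointP := disj _ _ (valP a') (valP a) aa'; apply.
move=> a; have := sum_memoryless (enc (fincl Am a)) hW.
rewrite (bigID (E a))/= => <-; rewrite lerBlDr lerD2l.
apply: le_trans c_eps.
pose F (m : messages c) := \sum_(y | 0 < closure_distortion R PS Si (val m) (val (dec c y)))
  memoryless W (enc m) y.
apply: le_trans (le_bigmax 0 F (fincl Am a)).
by rewrite [leLHS](_ : _ = F (fincl Am a))//; apply: eq_bigl => y; rewrite negbK.
Qed.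

End SemanticCoding.

(** The achievability clause asks for a nonempty [S j] because positive capacity gives output words,
    and a decoder must send each of them to some state. *)
Theorem theorem8 (R : realType) (U : countType) (PS : proof_system U)
    (lst : {fset U} -> seq U) (hlst : canonical_listing lst)
    (Agent : Type) (S : Agent -> {fset U})
    (SC SCh : finType)
    (hSC : forall k, (#|` S k| <= #|SC|)%N)
    (hSCh : (#|SC| <= #|SCh|)%N)
    (W : SC -> SCh -> R) (hW : is_kernel W) (hC : 0 < capacity W)
    (i j : Agent)
    (H1 : (Atom PS lst (S i) `<=` S j)%fset)
    (H2 : [set` (S j `\` S i)%fset] `<=` Cn PS [set` S i]) :
  let A := Atom PS lst (S i) in
  [/\ closure_fidelity R PS (S i) (S j) = 1,
      S j != fset0%fset ->
      (\forall n \near \oo, log2 (#|` A|%:R : R) / n%:R < capacity W) ->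
      exists c : forall n, block_code (S i) (S j) SC SCh n #|` S i|,
        (forall n, messages (c n) = S i) /\
        closure_error PS W (c n) @[n --> \oo] --> (0 : R)
    & (forall a1 a2, a1 \in A -> a2 \in A -> a1 != a2 ->
         [disjoint zero_distortion_set R PS (S i) (S j) a1
                 & zero_distortion_set R PS (S i) (S j) a2]%fset) ->
      forall (eps : R), 0 <= eps < 1 ->
      forall (n : nat) (c : block_code (S i) (S j) SC SCh n #|` S i|),
        closure_error PS W c <= eps ->
        log2 (#|` A|%:R : R) <= (n%:R * capacity W + 1) / (1 - eps)].
Proof.
have [ASi CA] := AtomP PS lst (S i).
have SjC : [set` S j] `<=` Cn PS [set` S i].
  move=> t /= tj; have [ti|ti] := boolP (t \in S i); first exact: Cn_refl.
  by apply: H2; rewrite /= in_fsetD ti.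
split.
(* One inclusion of closures is [SjC]; the other holds because [S j] contains the atoms, which
   generate the closure of [S i]. *)
- apply: closure_fidelity1; apply: Cn_eq => //.
  apply: subset_trans (@Cn_refl _ PS _) _; rewrite -CA.
  by apply: Cn_mono; exact/fsubsetP.
- by move=> Sj0 _; apply: exists_closure_code ASi CA H1 SjC Sj0.
- by move=> disj eps eps01 n c; apply: closure_code_converse.
Qed.
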